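(* Under the standing assumptions on the data described in the context, when $(\mathsf{CBP}_2)$ has no resource constraint (i.e. $\mathcal{R}=\varnothing$), it has an optimal solution with a constant assortment: there is an optimal solution $(w,\mathbf{v},x)$ of $(\mathsf{CBP}_2)$ and an assortment $\mathcal{A}\subseteq\mathcal{J}$ such that $w^{\mathcal{A}}=1$ and $w^{\mathcal{A}'}=0$ for all other $\mathcal{A}'\subseteq\mathcal{J}$.
   Context: Standing assumptions and data: $\mathcal{J}$ is a finite set of $J$ products. For each $j\in\mathcal{J}$ there are real numbers $\underline{x}_j\le\overline{x}_j$ (price bounds), $\psi_j$ (unit cost), $\alpha_j$, and $\beta_j>0$, such that $Q_j(x_j):=\exp(\alpha_j-\beta_jx_j)\in[0,1]$ for all $x_j\in[\underline{x}_j,\overline{x}_j]$. There are a vector $\theta=(\theta_j)_{j\in\mathcal{J}}\ge0$ with $\sum_{j\in\mathcal{J}}\theta_j=1$ and a matrix $\rho=(\rho_{ij})_{i,j\in\mathcal{J}}\ge0$ such that $I-\rho$ is nonsingular and $\sum_{n\ge1}\rho^n<\infty$ entrywise. $\overline{\lambda}\ge0$ is the total arrival volume (the integral of the arrival rate over the horizon). Problem $(\mathsf{CBP}_2)$ without resource constraints: over real $w=(w^{\mathcal{A}})_{\mathcal{A}\subseteq\mathcal{J}}$, $\mathbf{v}=(v_j^{\mathcal{A}})_{j\in\mathcal{J},\mathcal{A}\subseteq\mathcal{J}}$, $x=(x_j)_{j\in\mathcal{J}}$, maximize $$\sum_{\mathcal{A}\subseteq\mathcal{J}}\overline{\lambda}\,w^{\mathcal{A}}\sum_{j\in\mathcal{A}}(x_j-\psi_j)\exp(\alpha_j-\beta_jx_j)\,v_j^{\mathcal{A}}$$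 subject to: $\sum_{\mathcal{A}\subseteq\mathcal{J}}w^{\mathcal{A}}=1$; $w\ge0$; $v_j^{\mathcal{A}}=\theta_j+\sum_{i\in\mathcal{J}}[1-\mathbf{1}(i\in\mathcal{A})\exp(\alpha_i-\beta_ix_i)]\rho_{ij}v_i^{\mathcal{A}}$ for all $j\in\mathcal{J}$, $\mathcal{A}\subseteq\mathcal{J}$; $\underline{x}_j\le x_j\le\overline{x}_j$ for all $j$. *)

(* Defs.v *)
From mathcomp Require Import all_boot all_order all_algebra.
From mathcomp Require Import all_classical all_reals all_analysis.

Set Implicit Arguments.
Unset Strict Implicit.
Unset Printing Implicit Defensive.

Import Order.TTheory GRing.Theory Num.Theory.
Import numFieldNormedType.Exports.
Local Open Scope ring_scope.

(* Products are the elements of 'I_n, assortments those of {set 'I_n}. *)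
Record cbp_data (R : realType) (n : nat) := CbpData {
  xlow : 'I_n -> R;
  xupp : 'I_n -> R;
  psi : 'I_n -> R;
  alpha : 'I_n -> R;
  beta : 'I_n -> R;
  theta : 'I_n -> R;
  rho : 'M[R]_n;
  lambda_bar : R   (* total arrival volume over the horizon *)
}.

Definition purchase_prob (R : realType) (n : nat) (D : cbp_data R n)
    (j : 'I_n) (p : R) : R :=
  expR (alpha D j - beta D j * p).

Record standing_assumptions (R : realType) (n : nat) (D : cbp_data R n) :
    Prop := StandingAssumptions {
  price_bounds : forall j, xlow D j <= xupp D j;
  beta_gt0 : forall j, 0 < beta D j;
  purchase_prob_bounds : forall j p, xlow D j <= p <= xupp D j ->
    0 <= purchase_prob D j p <= 1;
  theta_ge0 : forall j, 0 <= theta D j;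
  theta_sum1 : \sum_j theta D j = 1;
  rho_ge0 : forall i j, 0 <= rho D i j;
  rho_nonsingular : 1%:M - rho D \in unitmx;
  rho_summable : forall i j,
    cvgn (series (fun k : nat => (rho D ^+ k.+1) i j));
  lambda_bar_ge0 : 0 <= lambda_bar D
}.

Definition cbp2_objective (R : realType) (n : nat) (D : cbp_data R n)
    (w : {set 'I_n} -> R) (v : 'I_n -> {set 'I_n} -> R) (x : 'I_n -> R) : R :=
  \sum_(A : {set 'I_n}) lambda_bar D * w A *
    \sum_(j in A) (x j - psi D j) * purchase_prob D j (x j) * v j A.

Record cbp2_feasible (R : realType) (n : nat) (D : cbp_data R n)
    (w : {set 'I_n} -> R) (v : 'I_n -> {set 'I_n} -> R) (x : 'I_n -> R) :
    Prop := Cbp2Feasible {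
  w_sum1 : \sum_(A : {set 'I_n}) w A = 1;
  w_ge0 : forall A, 0 <= w A;
  v_balance : forall (j : 'I_n) (A : {set 'I_n}),
    v j A = theta D j +
      \sum_i (1 - (i \in A)%:R * purchase_prob D i (x i)) * rho D i j * v i A;
  x_bounds : forall j, xlow D j <= x j <= xupp D j
}.

Definition cbp2_optimal (R : realType) (n : nat) (D : cbp_data R n)
    (w : {set 'I_n} -> R) (v : 'I_n -> {set 'I_n} -> R) (x : 'I_n -> R) :
    Prop :=
  cbp2_feasible D w v x /\
  forall w' v' x', cbp2_feasible D w' v' x' ->
    cbp2_objective D w' v' x' <= cbp2_objective D w v x.

(* Main.v *)
Require Import Defs.
From mathcomp Require Import all_boot all_order all_algebra.
From mathcomp Require Import all_classical all_reals all_analysis.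
Import Order.TTheory GRing.Theory Num.Theory.
Import numFieldNormedType.Exports.
Local Open Scope ring_scope.
Local Open Scope classical_set_scope.
Set Implicit Arguments.
Unset Strict Implicit.

(* For fixed prices x the balance equations decouple over assortments: the
   routing matrix of A is dominated entrywise by rho, whose powers tend to 0, so
   v^A is uniquely determined and the objective is lambda_bar times a convex
   combination of revenues revenue A x.  Each revenue A is continuous in x on the
   compact price box, hence attains its maximum there; the best of these finitely
   many maxima bounds every convex combination, so all weight can be put on the
   corresponding assortment. *)

Section MatrixLimits.
Variables (R : realType) (T : Type) (F : set_system T).
Context {FF : Filter F}.

Lemma cvg_sumr (I : Type) (r : seq I) (P : pred I) (f : I -> T -> R)
    (l : I -> R) : (forall i, P i -> f i x @[x --> F] --> l i) ->
  \sum_(i <- r | P i) f i x @[x --> F] --> \sum_(i <- r | P i) l i.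
Proof. by move=> fl; apply: cvg_big => //; exact: add_continuous. Qed.

Lemma cvg_mx_det n (M : T -> 'M[R]_n) (L : 'M[R]_n) :
  (forall i j, M x i j @[x --> F] --> L i j) ->
  \det (M x) @[x --> F] --> \det L.
Proof.
move=> cM; apply: cvg_sumr => s _.
apply: cvgM; first exact: cvg_cst.
by apply: cvg_big => [|i _]; [exact: mul_continuous | exact: cM].
Qed.

Lemma cvg_mx_adj n (M : T -> 'M[R]_n) (L : 'M[R]_n) (i j : 'I_n) :
  (forall i j, M x i j @[x --> F] --> L i j) ->
  (\adj (M x)) i j @[x --> F] --> (\adj L) i j.
Proof.
move=> cM; rewrite mxE; under eq_fun do rewrite mxE.
apply: cvgM; first exact: cvg_cst.
apply: cvg_mx_det => k l; rewrite !mxE.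
by under eq_fun do rewrite !mxE; exact: cM.
Qed.

End MatrixLimits.

Lemma ler_mx_exp (R : realType) n (A B : 'M[R]_n) k :
  (forall i j, 0 <= A i j <= B i j) ->
  forall i j, 0 <= (A ^+ k) i j <= (B ^+ k) i j.
Proof.
move=> AB; elim: k => [|k IH] i j.
  by rewrite !expr0 !mxE ler0n lexx.
rewrite !exprS !mxE; apply/andP; split.
  apply: sumr_ge0 => l _.
  by have /andP[? _] := AB i l; have /andP[? _] := IH l j; rewrite mulr_ge0.
apply: ler_sum => l _.
by have /andP[? ?] := AB i l; have /andP[? ?] := IH l j; rewrite ler_pM.
Qed.

(** A row vector [u] in the kernel satisfies [u = u *m A ^+ k] for every [k], while the powers of
    [A] are squeezed to 0 by those of [B]; hence [u = 0]. *)
Lemma unitmx_sub1_dominated (R : realType) n (A B : 'M[R]_n) :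
  (forall i j, 0 <= A i j <= B i j) ->
  (forall i j, (B ^+ k.+1) i j @[k --> \oo] --> (0 : R)) ->
  1%:M - A \in unitmx.
Proof.
move=> AB cB; rewrite -row_free_unit; apply: inj_row_free => u.
rewrite mulmxBr mulmx1 => /eqP; rewrite subr_eq0 => /eqP uA.
have uAk k : u = u *m (A ^+ k).
  elim: k => [|k IH]; first by rewrite expr0 mulmx1.
  by rewrite exprSr mulmxA -IH.
have cA i j : (A ^+ k.+1) i j @[k --> \oo] --> (0 : R).
  apply: (squeeze_cvgr (f := fun=> 0) _ (cvg_cst _) (cB i j)).
  by apply: nearW => k; exact: ler_mx_exp.
apply/rowP => j; rewrite [RHS]mxE.
(* A sequence constantly equal to [u 0 j] that tends to 0. *)
have su k : \sum_i u 0 i * (A ^+ k.+1) i j = u 0 j.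
  by rewrite [in RHS](uAk k.+1) mxE.
have : \sum_i u 0 i * (A ^+ k.+1) i j @[k --> \oo] -->
    \sum_i u 0 i * (0 : R).
  by apply: cvg_sumr => i _; apply: cvgM => //; exact: cvg_cst.
under eq_fun do rewrite su.
move/cvg_lim; rewrite lim_cst // => -> //.
by rewrite big1 // => i _; rewrite mulr0.
Qed.

Section Revenue.
Variables (R : realType) (n : nat) (D : cbp_data R n).
Implicit Types (A : {set 'I_n}) (x : 'I_n -> R).

Definition switch_mx A x : 'M[R]_n :=
  \matrix_(i, j) ((1 - (i \in A)%:R * purchase_prob D i (x i)) * rho D i j).

(* Cramer's rule for the row vector v with v (1 - switch_mx A x) = theta;
   this form is continuous in x wherever the determinant is nonzero. *)
Definition visits A x : 'rV[R]_n :=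
  (\det (1%:M - switch_mx A x))^-1 *:
    ((\row_j theta D j) *m \adj (1%:M - switch_mx A x)).

Definition revenue A x : R :=
  \sum_(j in A) (x j - psi D j) * purchase_prob D j (x j) * visits A x 0 j.

(** Prices are row vectors here because the compactness and extreme value results used below are
    about ['rV[R]_n]. *)
Definition price_box : set 'rV[R]_n :=
  [set y | forall j, `[xlow D j, xupp D j] (y ord0 j)].

Hypothesis hD : standing_assumptions D.

(** Purchase probabilities in [0, 1] keep the entries between 0 and those of [rho D], whose powers
    tend to 0 as terms of a convergent series. *)
Lemma switch_mx_unit A x : (forall j, xlow D j <= x j <= xupp D j) ->
  1%:M - switch_mx A x \in unitmx.
Proof.
move=> xb; apply: (@unitmx_sub1_dominated _ _ _ (rho D)) => i j; last first.
  exact/cvg_series_cvg_0/(rho_summable hD).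
have r0 := rho_ge0 hD i j.
have /andP[q0 q1] := purchase_prob_bounds hD (xb i).
rewrite mxE; case: (i \in A); rewrite ?mul1r ?mul0r ?subr0 ?mul1r ?r0 ?lexx //.
by rewrite mulr_ge0 ?subr_ge0 //= ler_piMl // gerBl.
Qed.

(** Both directions matter: one makes the constructed solution feasible, the other determines the
    [v] of any competitor. *)
Lemma balance_visits A x (v : 'I_n -> R) :
  (forall j, xlow D j <= x j <= xupp D j) ->
  (forall j, v j = theta D j +
     \sum_i (1 - (i \in A)%:R * purchase_prob D i (x i)) * rho D i j * v i) <->
  (forall j, v j = visits A x 0 j).
Proof.
move=> /(switch_mx_unit A) U.
have visE : visits A x = (\row_j theta D j) *m invmx (1%:M - switch_mx A x).
  by rewrite /visits /invmx U scalemxAr.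
have balE : (forall j, v j = theta D j +
     \sum_i (1 - (i \in A)%:R * purchase_prob D i (x i)) * rho D i j * v i) <->
   (\row_j v j) *m (1%:M - switch_mx A x) = \row_j theta D j.
  rewrite mulmxBr mulmx1; split => [e|/rowP e j].
    apply/rowP => j; rewrite !mxE {1}e.
    under [X in _ - X]eq_bigr do rewrite !mxE mulrC.
    by rewrite addrK.
  have := e j; rewrite !mxE => /eqP; rewrite subr_eq => /eqP ->.
  by congr (_ + _); apply: eq_bigr => i _; rewrite !mxE mulrC.
rewrite balE visE; split => [e j|e].
  by rewrite -e mulmxK // mxE.
have -> : \row_j v j = (\row_j theta D j) *m invmx (1%:M - switch_mx A x).
  by apply/rowP => j; rewrite mxE e.
by rewrite mulmxKV.
Qed.

(** Only the limit [l] has to lie in the box: that makes the limiting determinant nonzero, so the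
    quotient in Cramer's rule converges even if [x t] leaves the box. *)
Lemma cvg_revenue A (T : Type) (F : set_system T) {FF : Filter F}
    (x : T -> 'I_n -> R) (l : 'I_n -> R) :
  (forall j, xlow D j <= l j <= xupp D j) ->
  (forall j, x t j @[t --> F] --> l j) ->
  revenue A (x t) @[t --> F] --> revenue A l.
Proof.
move=> lb cx.
have cq j : purchase_prob D j (x t j) @[t --> F] --> purchase_prob D j (l j).
  have cl : alpha D j - beta D j * x t j @[t --> F] -->
            alpha D j - beta D j * l j.
    apply: cvgB; first exact: cvg_cst.
    by apply: cvgM => //; exact: cvg_cst.
  exact: (cvg_comp _ _ cl (@continuous_expR R _)).
have cM i j : (1%:M - switch_mx A (x t)) i j @[t --> F] -->
              (1%:M - switch_mx A l) i j.
  rewrite !mxE; under eq_fun do rewrite !mxE.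
  apply: cvgB; first exact: cvg_cst.
  apply: cvgM; last exact: cvg_cst.
  apply: cvgB; first exact: cvg_cst.
  by apply: cvgM => //; exact: cvg_cst.
apply: cvg_sumr => j _.
apply: cvgM.
  by apply: cvgM => //; apply: cvgB => //; exact: cvg_cst.
rewrite !mxE; under eq_fun do rewrite !mxE.
apply: cvgM.
  apply: cvgV; last exact: cvg_mx_det.
  by rewrite -unitfE; exact: switch_mx_unit.
apply: cvg_sumr => k _.
by apply: cvgM; [exact: cvg_cst | exact: cvg_mx_adj].
Qed.

Lemma revenue_max A : exists2 x, (forall j, xlow D j <= x j <= xupp D j) &
  forall x', (forall j, xlow D j <= x' j <= xupp D j) ->
    revenue A x' <= revenue A x.
Proof.
have row_box x : (forall j, xlow D j <= x j <= xupp D j) ->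
    \row_j x j \in price_box.
  by move=> xb; apply/mem_set; move=> j /=; rewrite in_itv mxE; exact: xb.
have [|||y] := @EVT_max_rV R n (fun y => revenue A (y ord0)) price_box.
- exists (\row_j xlow D j); apply/set_mem/row_box => j.
  by rewrite lexx (price_bounds hD).
- apply: (@rV_compact R n (fun j => `[xlow D j, xupp D j])) => j.
  exact: segment_compact.
- apply: continuous_in_subspaceT => z /set_mem zb.
  (* Left implicit, the filter gets unfolded to the definition of matrix
     neighbourhoods, for which no Filter instance is found. *)
  apply: (@cvg_revenue A _ _ (nbhs_filter z)) => j.
    by have := zb j; rewrite /= in_itv.
  exact: coord_continuous.
rewrite inE => yb ymax; exists (y ord0) => [j|x' /row_box /ymax].
  by have := yb j; rewrite /= in_itv.
by rewrite (_ : (\row_j x' j) ord0 = x') //; apply/funext => j; rewrite mxE.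
Qed.

Lemma objective_revenue w v x : cbp2_feasible D w v x ->
  cbp2_objective D w v x = lambda_bar D * \sum_A w A * revenue A x.
Proof.
move=> [_ _ vb xb]; rewrite mulr_sumr; apply: eq_bigr => A _.
rewrite -mulrA; congr (_ * (_ * _)); apply: eq_bigr => j _.
by congr (_ * _); apply: (balance_visits A (v^~ A) xb).1.
Qed.

End Revenue.

Theorem mainTheorem5 (R : realType) (n : nat) (D : cbp_data R n)
    (hD : standing_assumptions D) :
  exists (w : {set 'I_n} -> R) (v : 'I_n -> {set 'I_n} -> R) (x : 'I_n -> R)
         (A : {set 'I_n}),
    [/\ cbp2_optimal D w v x,
        w A = 1 &
        forall A' : {set 'I_n}, A' != A -> w A' = 0].
Proof.
have /choice[xm] : forall B, exists x, (forall j, xlow D j <= x j <= xupp D j) /\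
    forall x', (forall j, xlow D j <= x' j <= xupp D j) ->
      revenue D B x' <= revenue D B x.
  by move=> B; have [x xb xmax] := revenue_max hD B; exists x.
move=> xmP.
pose rev B := revenue D B (xm B).
have [A Amax] : exists A, forall B, rev B <= rev A.
  have [//|A _ Amax] := @arg_maxP _ _ _ finset.set0 xpredT rev.
  by exists A => B; apply: Amax.
pose w (B : {set 'I_n}) : R := (B == A)%:R.
(* The balance equations bind every assortment, including those of weight 0, all at the common
   prices [xm A]. *)
pose v j B := visits D B (xm A) 0 j.
have wsum (f : {set 'I_n} -> R) : \sum_B w B * f B = f A.
  rewrite (bigD1 A) //= /w eqxx mul1r big1 ?addr0 // => B /negbTE ->.
  by rewrite mul0r.
have [xAb _] := xmP A.
have feas : cbp2_feasible D w v (xm A).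
  split=> [|B|j B|//].
  - by rewrite -[RHS](wsum (fun=> 1)); apply: eq_bigr => B _; rewrite mulr1.
  - by rewrite /w ler0n.
  - by apply: (balance_visits hD B (v^~ B) xAb).2.
exists w, v, (xm A), A; split; last 2 first.
- by rewrite /w eqxx.
- by move=> B /negbTE; rewrite /w => ->.
split => // w' v' x' feas'.
have objE : cbp2_objective D w v (xm A) = lambda_bar D * rev A.
  rewrite (objective_revenue hD feas); congr (_ * _).
  exact: (wsum (fun B => revenue D B (xm A))).
rewrite (objective_revenue hD feas') objE.
apply: ler_wpM2l; first exact: lambda_bar_ge0 hD.
have [w1 w0 _ xb'] := feas'.
(* Spreading [rev A] over the weights [w'] allows a termwise comparison:
   [revenue D B x' <= rev B <= rev A]. *)
rewrite -[leRHS]mul1r -w1 mulr_suml; apply: ler_sum => B _.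
apply: ler_wpM2l; [exact: w0 | apply: le_trans (Amax B)].
by have [_] := xmP B; apply.
Qed.
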